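(* Let $\Phi \in \mathcal{S}^*(Z)$ and let $p\geq 0$ be real. Then $\Phi \in \mathcal{S}_p^*(Z)$ if and only if $$\sum_{\sigma \in \Gamma}\lambda_{\sigma}^{-2p}\big|\widehat{\Phi}(\sigma)\big|^2<\infty.$$ In that case, the norm $\|\Phi\|_{-p}$ of $\Phi$ in $\mathcal{S}_p^*(Z)$ satisfies $$\|\Phi\|_{-p}^2= \sum_{\sigma \in \Gamma}\lambda_{\sigma}^{-2p}\big|\widehat{\Phi}(\sigma)\big|^2.$$
   Context: $\mathbb{N}=\{0,1,2,\dots\}$ and $\Gamma$ is the set of all finite subsets of $\mathbb{N}$. $(\Omega,\mathcal{F},P)$ is a probability space with expectation $\mathbb{E}$. A discrete-time normal noise is a sequence $Z=(Z_n)_{n\in\mathbb{N}}$ of integrable (real) random variables on $\Omega$ with $\mathbb{E}[Z_n\mid\mathcal{F}_{n-1}]=0$ and $\mathbb{E}[Z_n^2\mid\mathcal{F}_{n-1}]=1$ for all $n\ge 0$, where $\mathcal{F}_{-1}=\{\emptyset,\Omega\}$ and $\mathcal{F}_n=\sigma(Z_k;0\le k\le n)$. Put $Z_\emptyset=1$ and $Z_\sigma=\prod_{i\in\sigma}Z_i$ for nonempty $\sigma\in\Gamma$; $\{Z_\sigma\mid\sigma\in\Gamma\}$ is an orthonormal system. Let $\mathcal{F}_\infty=\sigma(Z_n;n\in\mathbb{N})$ and let $\mathcal{L}^2(Z)=\mathcal{L}^2(\Omega,\mathcal{F}_\infty,P)$ (complex-valued functions), with inner product $\langle\cdot,\cdot\rangle$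 conjugate-linear in the first and linear in the second argument. $Z$ is a fixed discrete-time normal noise having the chaotic representation property: $\{Z_\sigma\}$ is total in $\mathcal{L}^2(Z)$, hence an orthonormal basis of it. $\lambda_\emptyset=1$ and $\lambda_\sigma=\prod_{k\in\sigma}(k+1)$ for nonempty $\sigma\in\Gamma$. For real $p\ge0$, $\mathcal{S}_p(Z)=\{\xi\in\mathcal{L}^2(Z)\mid\sum_{\sigma\in\Gamma}\lambda_\sigma^{2p}|\langle Z_\sigma,\xi\rangle|^2<\infty\}$, a Hilbert space with inner product $\langle\xi,\eta\rangle_p=\sum_\sigma\lambda_\sigma^{2p}\overline{\langle Z_\sigma,\xi\rangle}\langle Z_\sigma,\eta\rangle$ and norm $\|\cdot\|_p$. $\mathcal{S}(Z)=\bigcap_{p\ge0}\mathcal{S}_p(Z)$ has the topology generated by the norms $\|\cdot\|_p$, $p\ge 0$; it is dense in each $\mathcal{S}_p(Z)$ and contains every $Z_\sigma$. $\mathcal{S}^*(Z)$ is the dual (continuous linear functionals) of $\mathcal{S}(Z)$ with the strong topology. $\mathcal{S}_p^*(Z)$ is the dual of $\mathcal{S}_p(Z)$ with dual norm $\|\cdot\|_{-p}$, regarded via restriction to $\mathcal{S}(Z)$ as a subspace of $\mathcal{S}^*(Z)$. For $\Phi\in\mathcal{S}^*(Z)$, its Fock transform is the function $\widehat\Phi(\sigma)=\Phi(Z_\sigma)$, $\sigma\in\Gamma$. *)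

(* Defs.v *)
From HB Require Import structures.
From mathcomp Require Import all_boot all_order all_algebra finmap.
From mathcomp Require Import complex.
From mathcomp Require Import all_classical all_reals all_analysis.

Set Implicit Arguments.
Unset Strict Implicit.
Unset Printing Implicit Defensive.

Import Order.TTheory GRing.Theory Num.Theory.
Import numFieldNormedType.Exports.
Import ComplexField.Normc.

Local Open Scope classical_set_scope.
Local Open Scope complex_scope.
Local Open Scope ring_scope.

(* The subset D of V with the topology generated by the norms N k, k in K:
   the balls {y in D | N k (y - x) < e} with k in K and x in D form a
   subbase. *)
Definition normed_set (R : realType) (V : lmodType R[i]) (I : Type)
    (K : set I) (N : I -> V -> R) (D : set V) : Type := D.

HB.instance Definition _ (R : realType) (V : lmodType R[i]) (I : Type)
    (K : set I) (N : I -> V -> R) (D : set V) :=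
  Choice.on (normed_set K N D).

HB.instance Definition _ (R : realType) (V : lmodType R[i]) (I : pointedType)
    (K : set I) (N : I -> V -> R) (D : set V) :=
  @isSubBaseTopological.Build (normed_set K N D)
    ((I * (V : zmodType) * R)%type : pointedType)
    [set b | K b.1.1 /\ D b.1.2]
    (fun b => [set y : normed_set K N D | N b.1.1 (\val y - b.1.2) < b.2]).

(* Functionals on a linear subspace D of V are represented by total functions
   on V; only the values on D matter. *)
Definition linear_on (R : realType) (V : lmodType R[i]) (D : set V)
    (Phi : V -> R[i]) : Prop :=
  forall (a : R[i]) (x y : V), D x -> D y ->
    Phi (a *: x + y) = a * Phi x + Phi y.

Definition dual (R : realType) (V : lmodType R[i]) (I : pointedType)
    (K : set I) (N : I -> V -> R) (D : set V) : set (V -> R[i]) :=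
  [set Phi | linear_on D Phi /\
    continuous (fun x : normed_set K N D => Phi (\val x) : R[i]^o)].

Section Noise.
Context (R : realType) d (Omega : measurableType d) (P : probability Omega R).

Definition adapted (G : set (set Omega)) (X : Omega -> R) : Prop :=
  preimage_set_system setT X measurable `<=` G.

(* Y is a version of E[X | G], for a sub-sigma-algebra G. *)
Definition is_cond_expectation (G : set (set Omega)) (X Y : Omega -> R) :
    Prop :=
  [/\ P.-integrable setT (EFin \o X), P.-integrable setT (EFin \o Y),
      adapted G Y &
      forall A, G A -> (\int[P]_(w in A) (Y w)%:E = \int[P]_(w in A) (X w)%:E)%E].

Definition sigma_gen (Z : nat -> Omega -> R) (T : set nat) : set (set Omega) :=
  <<s \bigcup_(k in T) preimage_set_system setT (Z k) measurable >>.

(* sigma_gen Z `I_n is generated by Z_0, ..., Z_(n-1); it is trivial for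
   n = 0. *)
Definition normal_noise (Z : nat -> {RV P >-> R}) : Prop :=
  forall n : nat,
    [/\ P.-integrable setT (EFin \o Z n),
        is_cond_expectation (sigma_gen Z `I_n) (Z n) (cst 0) &
        is_cond_expectation (sigma_gen Z `I_n) (fun w => Z n w ^+ 2) (cst 1)].

(* Elements of L^2 are handled through representatives: a.e. equal functions
   have the same Fourier coefficients, hence are at distance 0 for all the
   norms below. *)
Definition cfun := Omega -> R[i]^o.

Definition L2 (Z : nat -> {RV P >-> R}) : set cfun :=
  [set xi | [/\ adapted (sigma_gen Z setT) (fun w => complex.Re (xi w)),
                adapted (sigma_gen Z setT) (fun w => complex.Im (xi w)) &
                P.-integrable setT (fun w => (normc (xi w) ^+ 2)%:E)]].

Definition inner (xi eta : cfun) : R[i] :=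
  (\int[P]_w complex.Re ((xi w)^* * eta w))
  +i* (\int[P]_w complex.Im ((xi w)^* * eta w)).

Definition L2norm (xi : cfun) : R := Num.sqrt (complex.Re (inner xi xi)).

Definition Zprod (Z : nat -> {RV P >-> R}) (sigma : {fset nat}) : cfun :=
  fun w => (\prod_(i <- sigma) Z i w)%:C.

Definition chaotic_representation (Z : nat -> {RV P >-> R}) : Prop :=
  forall xi, L2 Z xi -> forall e : R, 0 < e ->
    exists (s : seq {fset nat}) (c : {fset nat} -> R[i]),
      L2norm (xi - \sum_(sigma <- s) c sigma *: Zprod Z sigma) < e.

Definition lambda (sigma : {fset nat}) : R := \prod_(k <- sigma) k.+1%:R.

Definition sqnorm (Z : nat -> {RV P >-> R}) (p : R) (xi : cfun) : \bar R :=
  \esum_(sigma in [set: {fset nat}])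
    (lambda sigma `^ (2 * p) * normc (inner (Zprod Z sigma) xi) ^+ 2)%:E.

Definition Sp_space (Z : nat -> {RV P >-> R}) (p : R) : set cfun :=
  [set xi | L2 Z xi /\ (sqnorm Z p xi < +oo)%E].

Definition normp (Z : nat -> {RV P >-> R}) (p : R) (xi : cfun) : R :=
  Num.sqrt (fine (sqnorm Z p xi)).

Definition S_space (Z : nat -> {RV P >-> R}) : set cfun :=
  \bigcap_(p in [set p : R | 0 <= p]) Sp_space Z p.

Definition S_dual (Z : nat -> {RV P >-> R}) : set (cfun -> R[i]) :=
  dual [set p : R | 0 <= p] (normp Z) (S_space Z).

Definition Sp_dual (Z : nat -> {RV P >-> R}) (p : R) : set (cfun -> R[i]) :=
  dual [set p] (normp Z) (Sp_space Z p).

Definition restricts_to (Z : nat -> {RV P >-> R}) (Psi Phi : cfun -> R[i]) :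
    Prop :=
  forall xi, S_space Z xi -> Psi xi = Phi xi.

Definition dual_norm (Z : nat -> {RV P >-> R}) (p : R) (Psi : cfun -> R[i]) :
    R :=
  sup [set normc (Psi xi) | xi in [set xi | Sp_space Z p xi /\ normp Z p xi <= 1]].

Definition fock_transform (Z : nat -> {RV P >-> R}) (Phi : cfun -> R[i])
    (sigma : {fset nat}) : R[i] := Phi (Zprod Z sigma).

End Noise.

(* Main.v *)
(* The functionals Z_sigma are orthonormal because E[Z_n | F_(n-1)] = 0 and
   E[Z_n^2 | F_(n-1)] = 1: if n is the largest index of sigma and tau, factor
   out Z_n and condition on F_(n-1). Hence every xi in S_p is the limit in the
   p-norm of its finite Fourier sums, and a continuous functional is the
   unconditional sum of <Z_sigma, xi> Phi(Z_sigma). Weighted Cauchy-Schwarz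
   bounds this sum by the Fock series times the p-norm of xi, so a convergent
   Fock series defines an extension of Phi to S_p whose dual norm is at most the
   square root of the series. Conversely, evaluating the functional on
   sum_(sigma in F) lambda_sigma^(-2p) conj(Phi(Z_sigma)) Z_sigma bounds each
   finite part of the Fock series by the square of the dual norm. *)
Require Import Defs.
From mathcomp Require Import all_boot all_order all_algebra finmap complex.
From mathcomp Require Import all_classical all_reals all_analysis.
From mathcomp Require Import measurable_realfun lra ring.
Import Order.TTheory GRing.Theory Num.Theory.
Import numFieldNormedType.Exports.
Import ComplexField.Normc.
Local Open Scope classical_set_scope.
Local Open Scope complex_scope.
Local Open Scope ring_scope.

(** * Continuity for the topology generated by norms *)

(** The subbasic balls are centred anywhere in [D]. A neighbourhood of [x] contains a finite
    intersection of them, and the triangle inequality recentres each at [x]. *)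
Lemma nbhs_normed_set (R : realType) (V : lmodType R[i]) (I : pointedType)
    (K : set I) (N : I -> V -> R) (D : set V) :
  (forall k x y z, K k -> D x -> D y -> D z ->
    N k (x - z) <= N k (x - y) + N k (y - z)) ->
  forall (x : normed_set K N D) (A : set (normed_set K N D)), nbhs x A ->
  exists (s : seq I) (e : R), [/\ forall k, k \in s -> K k, 0 < e &
    forall y : normed_set K N D,
      (forall k, k \in s -> N k (\val y - \val x) < e) -> A y].
Proof.
move=> tri x A [B [[D' D'sub <-] [C D'C xC] BA]].
have [F FK FC] := D'sub _ D'C.
move: xC; rewrite -FC => xF.
have {BA FC}BA : \bigcap_(i in [set` F])
    [set y : normed_set K N D | N i.1.1 (\val y - i.1.2) < i.2] `<=` A.
  by move=> y yF; apply: BA; exists C => //; rewrite -FC.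
pose slack (b : I * V * R) := b.2 - N b.1.1 (\val x - b.1.2).
(* The smallest gap between a radius and the distance from [x] to the centre; the default 1 keeps
   [e] positive when [F] is empty. *)
pose e := \big[Num.min/1]_(b <- F) slack b.
exists [seq b.1.1 | b <- F], e; split.
- by move=> k /mapP[b bF ->]; have := FK b bF; rewrite inE => -[].
- rewrite /e big_seq; elim/big_ind : _ => //.
    by move=> u v u0 v0; rewrite lt_min u0.
  by move=> b bF; rewrite subr_gt0; exact: xF.
move=> y yF; apply: BA => b /= bF.
have [Kb Db] : K b.1.1 /\ D b.1.2 by have := FK b bF; rewrite inE.
have Dv (z : normed_set K N D) : D (\val z) by have := valP z; rewrite inE.
apply: le_lt_trans (tri _ _ _ _ Kb (Dv y) (Dv x) Db) _.
rewrite -ltrBrDr (lt_le_trans (yF _ (map_f _ bF)))//.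
exact: ge_bigmin_seq.
Qed.

Lemma dual_continuous_at (R : realType) (V : lmodType R[i]) (I : pointedType)
    (K : set I) (N : I -> V -> R) (D : set V) (Phi : V -> R[i]) :
  (forall k x y z, K k -> D x -> D y -> D z ->
    N k (x - z) <= N k (x - y) + N k (y - z)) ->
  dual K N D Phi -> forall (x : V) (e : R), D x -> 0 < e ->
  exists (s : seq I) (t : R), [/\ forall k, k \in s -> K k, 0 < t &
    forall y : V, D y -> (forall k, k \in s -> N k (y - x) < t) ->
      normc (Phi x - Phi y) < e].
Proof.
move=> tri [_ Phic] x e Dx e0.
have e0' : 0 < e%:C :> R[i] by rewrite ltcR.
pose x' : normed_set K N D := SigSub (mem_set Dx).
have Bx : nbhs (Phi x : R[i]^o) [set z | normc (Phi x - z) < e].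
  apply: filterS (@nbhsx_ballx _ R[i]^o (Phi x) _ e0') => z.
  by rewrite /ball/= ltcR.
have [s [t [sK t0 st]]] :=
  @nbhs_normed_set _ _ _ _ _ _ tri x' _ (Phic x' _ Bx).
exists s, t; split => // y Dy sy.
exact: (st (SigSub (mem_set Dy)) sy).
Qed.

(** The ball of radius [e / C] around [x] is itself subbasic, so it serves as the neighbourhood;
    [N k 0 = 0] puts [x] in it. *)
Lemma lipschitz_continuous (R : realType) (V : lmodType R[i])
    (I : pointedType) (k : I) (N : I -> V -> R) (D : set V) (Phi : V -> R[i])
    (C : R) :
  0 < C -> N k 0 = 0 ->
  (forall x y, D x -> D y -> normc (Phi x - Phi y) <= C * N k (y - x)) ->
  continuous (fun x : normed_set [set k] N D => Phi (\val x) : R[i]^o).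
Proof.
move=> C0 N0 Clip x; apply/(@cvgrPdist_lt _ R[i]^o _ _ (nbhs_filter x)) => -[e e'].
(* Positivity in [R[i]] forces the imaginary part to vanish, which leaves a real radius. *)
rewrite ltcE /= => /andP[/eqP -> e0].
have Dv (z : normed_set [set k] N D) : D (\val z).
  by have := valP z; rewrite inE.
set b := (k, (\val x : V), e / C) : (I * (V : zmodType) * R)%type.
pose B := [set y : normed_set [set k] N D | N k (\val y - \val x) < e / C].
exists B; split.
- exists [set B]; last by apply/seteqP; split=> [y [_ ->]//|y By]; exists B.
  by move=> _ ->; apply: (@finI_from1 _ _ _ _ b); split => //; exact: Dv.
- have : N k (\val x - \val x) < e / C by rewrite subrr N0 divr_gt0.
  by [].
move=> y xy; have : normc (Phi (\val x) - Phi (\val y)) < e.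
  apply: le_lt_trans (Clip _ _ (Dv x) (Dv y)) _.
  by rewrite mulrC -ltr_pdivlMr.
by rewrite -ltcR.
Qed.

Lemma linear_on0 (R : realType) (V : lmodType R[i]) (D : set V)
    (Phi : V -> R[i]) : linear_on D Phi -> D 0 -> Phi 0 = 0.
Proof.
move=> Phil D0; have := Phil (-1) 0 0 D0 D0.
by rewrite scaler0 addr0 mulN1r addNr.
Qed.

Lemma linear_onZ (R : realType) (V : lmodType R[i]) (D : set V)
    (Phi : V -> R[i]) (a : R[i]) (x : V) :
  linear_on D Phi -> D 0 -> D x -> Phi (a *: x) = a * Phi x.
Proof.
move=> Phil D0 Dx; have := Phil a x 0 Dx D0.
by rewrite (linear_on0 _ _ _ _ Phil D0) !addr0.
Qed.

(** * Unconditional sums *)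

Lemma normc_ge0 (R : rcfType) (z : R[i]) : 0 <= normc z.
Proof. by case: z => a b; exact: sqrtr_ge0. Qed.

Lemma normc_real (R : rcfType) (x : R) : normc x%:C = `|x|.
Proof. by rewrite /normc /= expr0n addr0 sqrtr_sqr. Qed.

Lemma normc_conj (R : rcfType) (z : R[i]) : normc z^* = normc z.
Proof. by case: z => a b /=; rewrite sqrrN. Qed.

Lemma normr_Re_le (R : rcfType) (z : R[i]) : `|complex.Re z| <= normc z.
Proof.
by case: z => x y /=; rewrite -sqrtr_sqr ler_wsqrtr// lerDl sqr_ge0.
Qed.

Lemma normr_Im_le (R : rcfType) (z : R[i]) : `|complex.Im z| <= normc z.
Proof.
by case: z => x y /=; rewrite -sqrtr_sqr ler_wsqrtr// lerDr sqr_ge0.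
Qed.

Lemma normc_sum (R : rcfType) (T : Type) (s : seq T) (f : T -> R[i]) :
  normc (\sum_(x <- s) f x) <= \sum_(x <- s) normc (f x).
Proof.
elim/big_ind2 : _ => // [|x1 y1 x2 y2 h1 h2]; first by rewrite normc0.
exact: le_trans (le_normcD _ _) (lerD h1 h2).
Qed.

(** Cauchy-Schwarz by induction. With u and v the roots of the two sums and |S| <= u v, adding a
    pair (a, b) reduces to 2 a b S <= (a v)^2 + (b u)^2. *)
Lemma sum_mul_sq_le (R : rcfType) (T : Type) (s : seq T) (a b : T -> R) :
  (\sum_(x <- s) a x * b x) ^+ 2
    <= (\sum_(x <- s) a x ^+ 2) * (\sum_(x <- s) b x ^+ 2).
Proof.
elim: s => [|x s]; first by rewrite !big_nil expr0n mul0r.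
rewrite !big_cons; set S := \sum_(y <- s) _; set A := \sum_(y <- s) _.
set B := \sum_(y <- s) _ => SAB.
have A0 : 0 <= A by apply: sumr_ge0 => ? _; exact: sqr_ge0.
have B0 : 0 <= B by apply: sumr_ge0 => ? _; exact: sqr_ge0.
have : `|S| <= Num.sqrt A * Num.sqrt B.
  by rewrite -sqrtrM// -sqrtr_sqr ler_sqrt// mulr_ge0.
rewrite -[in _ + A](sqr_sqrtr A0) -[in _ + B](sqr_sqrtr B0) ler_norml.
move: SAB; rewrite -[in S ^+ 2 <= _](sqr_sqrtr A0) -[in S ^+ 2 <= _](sqr_sqrtr B0).
move: (Num.sqrt A) (Num.sqrt B) => u v SAB /andP[S1 S2].
have h1 := sqr_ge0 (a x * v - b x * u); have h2 := sqr_ge0 (a x * v + b x * u).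
have abS : 2 * (a x * b x * S) <= (a x * v) ^+ 2 + (b x * u) ^+ 2.
  have [ab0|/ltW ab0] := leP 0 (a x * b x).
    have := ler_wpM2l ab0 S2; lra.
  have := ler_wnM2l ab0 S1; lra.
by move: SAB abS; rewrite !exprMn; lra.
Qed.

Lemma normc_sq (R : rcfType) (z : R[i]) :
  normc z ^+ 2 = complex.Re z ^+ 2 + complex.Im z ^+ 2.
Proof. by case: z => a b /=; rewrite sqr_sqrtr// addr_ge0// sqr_ge0. Qed.

Lemma normc_sqD (R : rcfType) (z z' : R[i]) :
  normc (z + z') ^+ 2 <= 2 * normc z ^+ 2 + 2 * normc z' ^+ 2.
Proof.
rewrite !normc_sq; case: z => a b; case: z' => a' b' /=.
by have := sqr_ge0 (a - a'); have := sqr_ge0 (b - b'); nra.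
Qed.

(** The factor 1 gives the bound the shape [k * X + Y] of [integrable_lincomb], where it serves as a
    dominating function. *)
Lemma mul_le_sqrD (R : realFieldType) (a b : R) : `|a * b| <= 1 * a ^+ 2 + b ^+ 2.
Proof.
rewrite normrM -(real_normK (num_real a)) -(real_normK (num_real b)).
by move: (normr_ge0 a) (normr_ge0 b); move: `|a| `|b| => u v; nra.
Qed.

(** Finite sets are directed by inclusion: the union of the thresholds works for all of [s]. It is
    applied to the finitely many norms that a neighbourhood constrains. *)
Lemma eventually_all (T : eqType) (s : seq T) (U : choiceType)
    (Q : T -> {fset U} -> Prop) :
  (forall k, k \in s -> exists F0, forall F, (F0 `<=` F)%fset -> Q k F) ->
  exists F0, forall F, (F0 `<=` F)%fset -> forall k, k \in s -> Q k F.
Proof.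
elim: s => [_|k s IH sQ]; first by exists fset0.
have [|F1 F1Q] := IH; first by move=> l ls; apply: sQ; rewrite inE ls orbT.
have [F2 F2Q] := sQ k (mem_head _ _).
exists (F1 `|` F2)%fset => F; rewrite fsubUset => /andP[/F1Q QF1 /F2Q QF2] l.
by rewrite inE => /predU1P[->|/QF1].
Qed.

Section Unconditional_sums.
Context (R : realType) (T : choiceType).
Implicit Types (a b w : T -> R) (f g : T -> R[i]) (F : {fset T}).

(** [\esum] is a supremum over finite sets; this passes between infinite sums and uniform bounds on
    finite ones. *)
Lemma esum_leP a (M : R) : (forall x, 0 <= a x) ->
  ((\esum_(x in [set: T]) (a x)%:E <= M%:E)%E
    <-> forall F, \sum_(x <- F) a x <= M).
Proof.
move=> a0; split=> [aM F|aM].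
  rewrite -lee_fin -sumEFin; apply: le_trans aM; apply: esum_ge.
  by exists [set` F] => //; rewrite -fsbig_seq.
apply: ge_ereal_sup => _ [A [finA _] <-].
by rewrite fsbig_finite//= sumEFin lee_fin.
Qed.

Lemma esum_ltyP a : (forall x, 0 <= a x) ->
  ((\esum_(x in [set: T]) (a x)%:E < +oo)%E
    <-> exists M, forall F, \sum_(x <- F) a x <= M).
Proof.
move=> a0; split=> [afin|[M aM]]; last first.
  by apply: le_lt_trans (ltry M); exact/esum_leP.
exists (fine (\esum_(x in [set: T]) (a x)%:E)); apply/esum_leP => //.
by rewrite fineK// ge0_fin_numE// esum_ge0// => x _; rewrite lee_fin.
Qed.

Lemma esum_fineK a : (forall x, 0 <= a x) ->
  (\esum_(x in [set: T]) (a x)%:E < +oo)%E ->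
  ((fine (\esum_(x in [set: T]) (a x)%:E))%:E
    = \esum_(x in [set: T]) (a x)%:E)%E.
Proof. 
by move=> a0 ?; rewrite fineK// ge0_fin_numE// esum_ge0// => x _; rewrite lee_fin.
Qed.

Lemma sum_le_fine_esum a F : (forall x, 0 <= a x) ->
  (\esum_(x in [set: T]) (a x)%:E < +oo)%E ->
  \sum_(x <- F) a x <= fine (\esum_(x in [set: T]) (a x)%:E).
Proof.
by move=> a0 afin; move: F; apply/esum_leP => //; rewrite esum_fineK.
Qed.

Lemma sum_fsubset_le a F G : (forall x, 0 <= a x) -> (F `<=` G)%fset ->
  \sum_(x <- F) a x <= \sum_(x <- G) a x.
Proof.
move=> a0 FG; rewrite (big_fsetID _ (mem F) G)/=.
rewrite (_ : [fset x in G | x \in F]%fset = F) ?lerDl ?sumr_ge0//.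
by apply/fsetP => x; rewrite !inE/= andb_idl//; exact: (fsubsetP FG).
Qed.

Lemma esum_near a : (forall x, 0 <= a x) ->
  (\esum_(x in [set: T]) (a x)%:E < +oo)%E -> forall e : R, 0 < e ->
  exists F0, forall F, (F0 `<=` F)%fset ->
    fine (\esum_(x in [set: T]) (a x)%:E) - e < \sum_(x <- F) a x.
Proof.
move=> a0 afin e e0; apply: contrapT => /forallNP H.
have : (\esum_(x in [set: T]) (a x)%:E
    <= (fine (\esum_(x in [set: T]) (a x)%:E) - e)%:E)%E.
  apply/esum_leP => // F; rewrite leNgt; apply/negP => Flt.
  by apply: (H F) => G FG; exact: lt_le_trans Flt (sum_fsubset_le _ _ _ a0 FG).
rewrite -[leLHS]esum_fineK// lee_fin; lra.
Qed.

Lemma esum_tail a : (forall x, 0 <= a x) ->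
  (\esum_(x in [set: T]) (a x)%:E < +oo)%E -> forall e : R, 0 < e ->
  exists F0, forall F, (F0 `<=` F)%fset ->
    (\esum_(x in [set: T]) (if x \in F then 0 else a x)%:E <= e%:E)%E.
Proof.
move=> a0 afin e e0; have [F0 F0P] := esum_near _ a0 afin _ e0.
exists F0 => F /F0P FS; apply/esum_leP => [x|G]; first by case: ifP.
have := sum_le_fine_esum _ (F `|` G)%fset a0 afin.
suff -> : \sum_(x <- (F `|` G)%fset) a x = \sum_(x <- F) a x +
  \sum_(x <- G) (if x \in F then 0 else a x) by lra.
rewrite (big_fsetID _ (mem F) (F `|` G)%fset)/=; congr (_ + _).
  by apply: eq_fbigl => x; rewrite !inE/=; case: (x \in F); rewrite ?andbF.
rewrite [RHS](big_fsetID _ (mem F))/= [X in _ = X + _]big1_fset ?add0r.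
  rewrite [RHS](@eq_fbigr _ _ _ _ _ _ _ a).
    by apply: eq_fbigl => x; rewrite !inE/=; case: (x \in F); case: (x \in G).
  by move=> x; rewrite !inE/= => /andP[_ /negbTE ->].
by move=> x; rewrite !inE/= => /andP[_ ->].
Qed.

(** Cauchy-Schwarz for [a] times the root of [w] against [b] divided by it. *)
Lemma weighted_cauchy_schwarz (s : seq T) w a b : (forall x, 0 < w x) ->
  (\sum_(x <- s) a x * b x) ^+ 2
    <= (\sum_(x <- s) w x * a x ^+ 2) * (\sum_(x <- s) (w x)^-1 * b x ^+ 2).
Proof.
move=> w0.
have := sum_mul_sq_le _ _ s (fun x => Num.sqrt (w x) * a x)
  (fun x => (Num.sqrt (w x))^-1 * b x).
rewrite (eq_bigr (fun x => a x * b x)); last first.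
  move=> x _; rewrite mulrACA mulfV ?mul1r// gt_eqF// sqrtr_gt0//.
congr (_ <= _ * _); apply: eq_bigr => x _; rewrite exprMn ?exprVn sqr_sqrtr//;
  exact: ltW.
Qed.

(** On a finite set, expand (|f| + |g|)^2 and bound the cross term by Cauchy-Schwarz, each factor
    taking the root of [w]. The finite sums are then compared with the full ones. *)
Lemma minkowski w f g : (forall x, 0 <= w x) ->
  (\esum_(x in [set: T]) (w x * normc (f x) ^+ 2)%:E < +oo)%E ->
  (\esum_(x in [set: T]) (w x * normc (g x) ^+ 2)%:E < +oo)%E ->
  (\esum_(x in [set: T]) (w x * normc (f x + g x) ^+ 2)%:E <=
   ((Num.sqrt (fine (\esum_(x in [set: T]) (w x * normc (f x) ^+ 2)%:E))
    + Num.sqrt (fine (\esum_(x in [set: T]) (w x * normc (g x) ^+ 2)%:E)))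
      ^+ 2)%:E)%E.
Proof.
move=> w0 ffin gfin.
have wn0 h x : 0 <= w x * normc (h x) ^+ 2 by rewrite mulr_ge0// sqr_ge0.
apply/esum_leP => [x|F]; first exact: (wn0 (fun x => f x + g x)).
have := sum_le_fine_esum _ F (wn0 f) ffin.
have := sum_le_fine_esum _ F (wn0 g) gfin.
move: (fine _) (fine _) => A B.
set V := \sum_(x <- F) _ => VB; set U := \sum_(x <- F) _ => UA.
have U0 : 0 <= U by exact: sumr_ge0.
have V0 : 0 <= V by exact: sumr_ge0.
apply: (@le_trans _ _ ((Num.sqrt U + Num.sqrt V) ^+ 2)); last first.
  by rewrite lerXn2r ?nnegrE ?addr_ge0 ?sqrtr_ge0// lerD// ler_wsqrtr.
rewrite sqrrD !sqr_sqrtr//.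
have CS : \sum_(x <- F) w x * (normc (f x) * normc (g x))
    <= Num.sqrt U * Num.sqrt V.
  have := sum_mul_sq_le _ _ F (fun x => Num.sqrt (w x) * normc (f x))
    (fun x => Num.sqrt (w x) * normc (g x)).
  rewrite (eq_bigr (fun x => w x * (normc (f x) * normc (g x)))); last first.
    by move=> x _; rewrite mulrACA -expr2 sqr_sqrtr.
  rewrite [X in X * _](eq_bigr (fun x => w x * normc (f x) ^+ 2)); last first.
    by move=> x _; rewrite exprMn sqr_sqrtr.
  rewrite [X in _ * X](eq_bigr (fun x => w x * normc (g x) ^+ 2)); last first.
    by move=> x _; rewrite exprMn sqr_sqrtr.
  rewrite -/U -/V -sqrtrM// => /ler_wsqrtr; rewrite sqrtr_sqr.
  exact: le_trans (ler_norm _).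
apply: (@le_trans _ _ (U + (\sum_(x <- F) w x * (normc (f x) * normc (g x))) *+ 2 + V)).
  rewrite /U /V -mulr_natl mulr_sumr -!big_split/=; apply: ler_sum => x _.
  have := le_normcD (f x) (g x); have := normc_ge0 _ (f x + g x).
  move: (w0 x) (normc_ge0 _ (f x)) (normc_ge0 _ (g x)).
  move: (normc _) (normc _) (normc _) => u v z wx v0 u0 z0 zuv.
  have : u ^+ 2 <= (z + v) ^+ 2 by rewrite lerXn2r ?nnegrE ?addr_ge0.
  by move=> /(ler_wpM2l wx); rewrite sqrrD; lra.
by rewrite lerD2r lerD2l lerMn2r.
Qed.

(** Convergence of the net of finite partial sums, which depends on no enumeration of the index
    type. *)
Definition has_sum f (z : R[i]) := forall e : R, 0 < e ->
  exists F0, forall F, (F0 `<=` F)%fset -> normc (\sum_(x <- F) f x - z) < e.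

Lemma has_sum_le f z (M : R) : has_sum f z ->
  (forall F, normc (\sum_(x <- F) f x) <= M) -> normc z <= M.
Proof.
move=> fz fM; apply/ler_addgt0Pl => e /fz[F0 /(_ F0 (fsubset_refl _)) ze].
have := le_normcD (\sum_(x <- F0) f x) (- (\sum_(x <- F0) f x - z)).
rewrite normcN opprB addrCA subrr addr0 => /le_trans; apply.
by rewrite addrC lerD// ltW.
Qed.

Lemma has_sum_unique f z z' : has_sum f z -> has_sum f z' -> z = z'.
Proof.
move=> fz fz'; apply/eqP; rewrite -subr_eq0; apply/eqP/eq0_normc/eqP.
rewrite eq_le normc_ge0 andbT; apply/ler_addgt0Pl => e e0; rewrite addr0.
have e2 : 0 < e / 2 by rewrite divr_gt0.
have [F Fz] := fz _ e2; have [F' Fz'] := fz' _ e2.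
have {}Fz := Fz _ (fsubsetUl F F'); have {}Fz' := Fz' _ (fsubsetUr F F').
rewrite (splitr e) -(subrKA (\sum_(x <- (F `|` F')%fset) f x)) addrC.
rewrite (le_trans (le_normcD _ _))// lerD// 1?ltW//.
by rewrite -normcN opprB.
Qed.

Lemma has_sum_linear (k : R[i]) f g y z : has_sum f y -> has_sum g z ->
  has_sum (fun x => k * f x + g x) (k * y + z).
Proof.
move=> fy gz e e0.
(* The added 1 allows division by this quantity even when [k] is 0. *)
have k0 : 0 < 2 * (normc k + 1).
  by rewrite mulr_gt0// ltr_wpDl ?normc_ge0.
have [F Fy] := fy _ (divr_gt0 e0 k0).
have [G Gz] := gz _ (divr_gt0 e0 (@ltr0Sn R 1)).
exists (F `|` G)%fset => H; rewrite fsubUset => /andP[/Fy yH /Gz zH].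
rewrite big_split/= -mulr_sumr opprD addrACA -mulrBr.
apply: le_lt_trans (le_normcD _ _) _; rewrite normcM (splitr e).
apply: ler_ltD zH; have := normc_ge0 _ k; move: (normc k) k0 yH => n n0.
rewrite ltr_pdivlMr// => yH n1; move: (normc_ge0 _ (\sum_(i <- H) f i - y)) yH.
by move: (normc _) => r r0 yH; nra.
Qed.

Lemma has_sum_ge0 a : (forall x, 0 <= a x) ->
  (\esum_(x in [set: T]) (a x)%:E < +oo)%E ->
  has_sum (fun x => (a x)%:C) (fine (\esum_(x in [set: T]) (a x)%:E))%:C.
Proof.
move=> a0 afin e e0; have [F0 F0P] := esum_near _ a0 afin _ e0.
exists F0 => F /F0P Fe; rewrite -rmorph_sum -rmorphB normc_real ltr_norml.
have := sum_le_fine_esum _ F a0 afin; lra.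
Qed.

(** Absolute convergence suffices: the positive and negative parts of the real and imaginary parts
    are nonnegative and dominated by [normc (f x)]. Their four sums recombine with the coefficients
    -1 and ['i]. *)
Lemma has_sum_exists f :
  (\esum_(x in [set: T]) (normc (f x))%:E < +oo)%E -> exists z, has_sum f z.
Proof.
move=> ffin.
have part (h : R[i] -> R) : (forall z, 0 <= h z <= normc z) ->
    exists z, has_sum (fun x => (h (f x))%:C) z.
  move=> hn; eexists; apply: has_sum_ge0 => [x|]; first by have /andP[] := hn (f x).
  apply: le_lt_trans ffin; apply: le_esum => x _; rewrite lee_fin.
  by have /andP[] := hn (f x).
have [z1 h1] : exists z, has_sum (fun x => (Num.max (complex.Re (f x)) 0)%:C) z.
  apply: (part (fun z => Num.max (complex.Re z) 0)) => z; rewrite le_max lexx orbT/=.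
  rewrite ge_max normc_ge0 andbT (le_trans (ler_norm _))//.
  by rewrite normr_Re_le.
have [z2 h2] : exists z, has_sum (fun x => (Num.max (- complex.Re (f x)) 0)%:C) z.
  apply: (part (fun z => Num.max (- complex.Re z) 0)) => z; rewrite le_max lexx orbT/=.
  rewrite ge_max normc_ge0 andbT (le_trans (ler_norm _))// normrN.
  by rewrite normr_Re_le.
have [z3 h3] : exists z, has_sum (fun x => (Num.max (complex.Im (f x)) 0)%:C) z.
  apply: (part (fun z => Num.max (complex.Im z) 0)) => z; rewrite le_max lexx orbT/=.
  rewrite ge_max normc_ge0 andbT (le_trans (ler_norm _))//.
  by rewrite normr_Im_le.
have [z4 h4] : exists z, has_sum (fun x => (Num.max (- complex.Im (f x)) 0)%:C) z.
  apply: (part (fun z => Num.max (- complex.Im z) 0)) => z; rewrite le_max lexx orbT/=.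
  rewrite ge_max normc_ge0 andbT (le_trans (ler_norm _))// normrN.
  by rewrite normr_Im_le.
have := has_sum_linear 'i _ _ _ _ (has_sum_linear (-1) _ _ _ _ h4 h3)
  (has_sum_linear (-1) _ _ _ _ h2 h1).
set g := (fun x : T => _); rewrite (_ : g = f) => [fz|]; first by eexists; exact: fz.
apply/funext => x; rewrite /g; case: (f x) => u v; apply/eqP.
rewrite eq_complex /=.
have maxE (t : R) : Num.max t 0 - Num.max (- t) 0 = t.
  by case: (leP t 0) => ht; case: (leP (- t) 0) => ht'; lra.
apply/andP; split; apply/eqP; have := maxE u; have := maxE v; lra.
Qed.

End Unconditional_sums.

(** * Conditional expectation *)

Section Conditioning.
Context (R : realType) d (Omega : measurableType d) (P : probability Omega R).
Implicit Types (C : set (set Omega)) (f X Y : Omega -> R).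
Import HBNNSimple.

Lemma adaptedP C f :
  adapted <<s C>> f <-> measurable_fun [set: g_sigma_algebraType C] f.
Proof.
split=> [fC _ B mB|mf _ [B mB <-]]; last exact: mf.
by apply: fC; exists B.
Qed.

Lemma adapted_measurable C f : C `<=` d.-measurable ->
  adapted <<s C>> f -> measurable_fun setT f.
Proof.
move=> CM fC _ B mB.
have := fC _ (ex_intro2 _ _ B mB erefl).
by apply: smallest_sub => //; exact: sigma_algebra_measurable.
Qed.

(** The level sets of [h] belong to [<<s C>>], so this formula reduces the integral of [h * X] to
    integrals of [X] over sets on which a conditional expectation is tested. *)
Lemma integral_nnsfunM C (h : {nnsfun g_sigma_algebraType C >-> R}) X :
  C `<=` d.-measurable -> (forall w, 0 <= X w) -> measurable_fun setT X ->
  (\int[P]_w (h w * X w)%:E = \sum_(y \in range h)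
    y%:E * \int[P]_(w in (h : Omega -> R) @^-1` [set y]) (X w)%:E)%E.
Proof.
move=> CM X0 mX.
have mh y : d.-measurable ((h : Omega -> R) @^-1` [set y]).
  have : <<s C>> ((h : Omega -> R) @^-1` [set y]) by exact: (measurable_funPTI h).
  by apply: smallest_sub => //; exact: sigma_algebra_measurable.
transitivity (\int[P]_w (\sum_(y \in range h)
    (y%:E * ((fun w => (X w)%:E) \_ ((h : Omega -> R) @^-1` [set y])) w)))%E.
  apply: eq_integral => w _; rewrite EFinM.
  rewrite fsbig_finite//= (bigD1_seq (h w))//=; last 2 first.
  - by rewrite in_fset_set// inE; exists w.
  - exact: fset_uniq.
  rewrite patchE mem_set// big1 ?adde0// => y yh.
  by rewrite patchE memNset ?mule0// => /= /esym/eqP; rewrite (negbTE yh).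
have V0 y w : (0 <= (((fun w => (X w)%:E) \_
    ((h : Omega -> R) @^-1` [set y])) w))%E.
  by rewrite patchE; case: ifP; rewrite ?lee_fin.
have mV y : measurable_fun setT ((fun w => (X w)%:E) \_
    ((h : Omega -> R) @^-1` [set y])).
  by apply/(measurable_restrictT _ (mh y)).1/measurable_funTS/measurable_EFinP.
rewrite ge0_integral_fsum//.
- apply: eq_fsbigr => y; rewrite inE => -[w _ <-].
  by rewrite ge0_integralZl// ?lee_fin// -integral_mkcond.
- by move=> y; exact: measurable_funeM.
(* For negative [y] the level set is empty, because [h] is nonnegative. *)
- move=> y w _; have [y0|y0] := leP 0 y; first by rewrite mule_ge0.
  rewrite patchE; case: ifP => [|_]; last by rewrite mule0.
  rewrite inE/= => hw; have : 0 <= h w by exact: fun_ge0.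
  by rewrite hw leNgt y0.
Qed.

(** For simple [f], compare the integrals level set by level set; in general, approximate [f] from
    below by [<<s C>>]-measurable simple functions and use monotone convergence. Both sides may be
    infinite. *)
Lemma ge0_pull_out C f X Y : C `<=` d.-measurable -> adapted <<s C>> f ->
  (forall w, 0 <= f w) -> (forall w, 0 <= X w) -> (forall w, 0 <= Y w) ->
  measurable_fun setT X -> measurable_fun setT Y ->
  (forall A, <<s C>> A ->
    \int[P]_(w in A) (X w)%:E = \int[P]_(w in A) (Y w)%:E)%E ->
  (\int[P]_w (f w * X w)%:E = \int[P]_w (f w * Y w)%:E)%E.
Proof.
move=> CM fC f0 X0 Y0 mX mY XY.
have mf : measurable_fun [set: g_sigma_algebraType C] (EFin \o f).
  exact/measurable_EFinP/adaptedP.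
pose h := nnsfun_approx measurableT mf.
have lim (V : Omega -> R) : (forall w, 0 <= V w) -> measurable_fun setT V ->
    (\int[P]_w (h n w * V w)%:E @[n --> \oo] --> \int[P]_w (f w * V w)%:E)%E.
  move=> V0 mV.
  rewrite (_ : (fun w => (f w * V w)%:E) =
      (fun w => limn (fun n => (h n w * V w)%:E))); last first.
    apply/funext => w; apply/esym/cvg_lim => //.
    rewrite EFinM; under eq_fun do rewrite EFinM.
    apply: cvgeZr => //.
    by apply: (cvg_nnsfun_approx measurableT mf) => // ? _; rewrite lee_fin.
  apply: cvg_monotone_convergence => //.
  - move=> n; apply/measurable_EFinP/measurable_funM => //.
    by apply: (@adapted_measurable C (h n)) => //; exact/adaptedP/measurable_funPT.
  - by move=> m w _; rewrite lee_fin mulr_ge0.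
  - move=> w _ m n mn; rewrite lee_fin ler_wpM2r//.
    by have /lefP := nd_nnsfun_approx measurableT mf mn.
have <- := cvg_lim _ (lim X X0 mX); last by [].
have <- := cvg_lim _ (lim Y Y0 mY); last by [].
suff -> : (fun n => \int[P]_w (h n w * X w)%:E)%E =
  (fun n => \int[P]_w (h n w * Y w)%:E)%E by [].
apply/funext => n; rewrite (integral_nnsfunM C (h n) X)//.
rewrite (integral_nnsfunM C (h n) Y)//.
apply: eq_fsbigr => y _; congr (_ * _)%E; apply: XY.
exact: (measurable_funPTI (h n)).
Qed.

Lemma integrable_dominated f Y : measurable_fun setT f ->
  (forall w, `|f w| <= Y w) -> P.-integrable setT (fun w => (Y w)%:E) ->
  P.-integrable setT (fun w => (f w)%:E).
Proof.
move=> mf fY; apply: le_integrable => //; first exact/measurable_EFinP.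
by move=> w _; rewrite lee_fin (le_trans (fY w))// ler_norm.
Qed.

Lemma integrable_lincomb (k : R) X Y :
  P.-integrable setT (fun w => (X w)%:E) ->
  P.-integrable setT (fun w => (Y w)%:E) ->
  P.-integrable setT (fun w => (k * X w + Y w)%:E).
Proof.
move=> iX iY; rewrite (_ : (fun w => _) =
  (fun w => k%:E * (X w)%:E)%E \+ (fun w => (Y w)%:E))%E.
  by apply: integrableD => //; exact: integrableZl.
by apply/funext => w; rewrite /= EFinD EFinM.
Qed.

Lemma Rintegral_lincomb (A : set Omega) (k : R) X Y : measurable A ->
  P.-integrable setT (fun w => (X w)%:E) ->
  P.-integrable setT (fun w => (Y w)%:E) ->
  \int[P]_(w in A) (k * X w + Y w)
    = k * \int[P]_(w in A) X w + \int[P]_(w in A) Y w.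
Proof.
move=> mA /(integrableS measurableT mA (@subsetT _ _)) iX.
move=> /(integrableS measurableT mA (@subsetT _ _)) iY.
rewrite RintegralD//; first by rewrite RintegralZl.
rewrite (_ : _ \o _ = (fun w => k%:E * (X w)%:E)%E); first exact: integrableZl.
by apply/funext => w; rewrite /= EFinM.
Qed.

Lemma EFin_Rintegral (A : set Omega) X : measurable A ->
  P.-integrable setT (fun w => (X w)%:E) ->
  (\int[P]_(w in A) (X w)%:E)%E = (\int[P]_(w in A) X w)%:E.
Proof.
move=> mA /(integrableS measurableT mA (@subsetT _ _)) iX.
by rewrite /Rintegral fineK//; exact: integrable_fin_num.
Qed.

(* Signed [X] and [Y] reduce to the nonnegative case through
   [X^+ + Y^-] and [Y^+ + X^-], which have equal integrals over <<s C>>. *)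
Lemma pull_out C f X Y : C `<=` d.-measurable -> adapted <<s C>> f ->
  is_cond_expectation P <<s C>> X Y ->
  P.-integrable setT (fun w => (f w * X w)%:E) ->
  P.-integrable setT (fun w => (f w * Y w)%:E) ->
  \int[P]_w (f w * X w) = \int[P]_w (f w * Y w).
Proof.
move=> CM fC [iX iY YC XY] ifX ifY.
have mX : measurable_fun setT X by exact/measurable_EFinP/(measurable_int P).
have mY : measurable_fun setT Y by exact: adapted_measurable YC.
have mf : measurable_fun setT f by exact: adapted_measurable fC.
pose U w := X^\+ w + Y^\- w; pose V w := Y^\+ w + X^\- w.
have mU : measurable_fun setT U.
  by apply: measurable_funD; [exact: measurable_funrpos|exact: measurable_funrneg].
have mV : measurable_fun setT V.
  by apply: measurable_funD; [exact: measurable_funrpos|exact: measurable_funrneg].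
have posneg (t : R) : Num.max t 0 - Num.max (- t) 0 = t.
  by case: (leP t 0) => ht; case: (leP (- t) 0) => ht'; lra.
have posabs (t : R) : 0 <= Num.max t 0 <= `|t|.
  by rewrite le_max lexx orbT/= ge_max ler_norm normr_ge0.
have negabs (t : R) : 0 <= Num.max (- t) 0 <= `|t|.
  by rewrite -normrN; exact: posabs.
(* That is, U - V = X - Y. *)
have UV w : U w = -1 * Y w + (X w + V w).
  by rewrite /U /V; have := posneg (X w); have := posneg (Y w);
    rewrite !/(_^\+) !/(_^\-); lra.
have U0 w : 0 <= U w by rewrite addr_ge0// ?funrpos_ge0 ?funrneg_ge0.
have V0 w : 0 <= V w by rewrite addr_ge0// ?funrpos_ge0 ?funrneg_ge0.
have iN (W : Omega -> R) : P.-integrable setT (fun w => (W w)%:E) ->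
    P.-integrable setT (fun w => `|W w|%:E).
  by move=> iW; exact: (integrable_abse iW).
have UVle w : `|U w| <= 1 * `|X w| + `|Y w|.
  rewrite ger0_norm// mul1r lerD//; first by have /andP[] := posabs (X w).
  by have /andP[] := negabs (Y w).
have VUle w : `|V w| <= 1 * `|X w| + `|Y w|.
  rewrite ger0_norm// mul1r addrC lerD//; first by have /andP[] := posabs (Y w).
  by have /andP[] := negabs (X w).
have iU : P.-integrable setT (fun w => (U w)%:E).
  apply: integrable_dominated UVle _ => //.
  exact: integrable_lincomb (iN _ iX) (iN _ iY).
have iV : P.-integrable setT (fun w => (V w)%:E).
  apply: integrable_dominated VUle _ => //.
  exact: integrable_lincomb (iN _ iX) (iN _ iY).
have intUV A : <<s C>> A ->
    (\int[P]_(w in A) (U w)%:E = \int[P]_(w in A) (V w)%:E)%E.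
  move=> CA; have mA : measurable A.
    by apply: smallest_sub CA => //; exact: sigma_algebra_measurable.
  have := XY A CA; rewrite !EFin_Rintegral// => -[XYA]; congr EFin.
  transitivity (\int[P]_(w in A) (-1 * Y w + (1 * X w + V w))).
    by apply: eq_Rintegral => w _; rewrite UV mul1r.
  rewrite !Rintegral_lincomb//; first by lra.
  exact: integrable_lincomb.
(* Used for [g] the positive and the negative part of [f]. The function |f X| + |f Y| dominates both
   [g * U] and [g * V]. *)
have part (g : Omega -> R) : adapted <<s C>> g ->
    (forall w, 0 <= g w <= `|f w|) ->
    [/\ P.-integrable setT (fun w => (g w * U w)%:E),
       P.-integrable setT (fun w => (g w * V w)%:E) &
       \int[P]_w (g w * U w) = \int[P]_w (g w * V w)].
  move=> gC gf; have g0 w : 0 <= g w by have /andP[] := gf w.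
  have mg : measurable_fun setT g by exact: adapted_measurable gC.
  have ifXY : P.-integrable setT (fun w => (1 * `|f w * X w| + `|f w * Y w|)%:E).
    exact: integrable_lincomb (iN _ ifX) (iN _ ifY).
  have dom (W : Omega -> R) : measurable_fun setT W ->
      (forall w, `|W w| <= 1 * `|X w| + `|Y w|) ->
      P.-integrable setT (fun w => (g w * W w)%:E).
    move=> mW Wle; apply: integrable_dominated ifXY; first exact: measurable_funM.
    move=> w; rewrite mul1r !normrM -mulrDr (ger0_norm (g0 w)) ler_pM//.
    - by have /andP[] := gf w.
    - by rewrite -[X in _ <= X + _]mul1r.
  split; [exact: dom|exact: dom|congr fine].
  exact: (ge0_pull_out C).
have /adaptedP mfC := fC.
have [ifpU ifpV fpUV] : [/\ P.-integrable setT (fun w => (f^\+ w * U w)%:E),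
    P.-integrable setT (fun w => (f^\+ w * V w)%:E) &
    \int[P]_w (f^\+ w * U w) = \int[P]_w (f^\+ w * V w)].
  by apply: part => [|w]; [exact/adaptedP/measurable_funrpos|exact: posabs].
have [ifnU ifnV fnUV] : [/\ P.-integrable setT (fun w => (f^\- w * U w)%:E),
    P.-integrable setT (fun w => (f^\- w * V w)%:E) &
    \int[P]_w (f^\- w * U w) = \int[P]_w (f^\- w * V w)].
  by apply: part => [|w]; [exact/adaptedP/measurable_funrneg|exact: negabs].
(* Both integrands are f (X - Y) = (f^+ - f^-) (U - V), and the right-hand integral vanishes by the
   two instances of [part]. *)
have : \int[P]_w (-1 * (f w * Y w) + f w * X w) =
    \int[P]_w (-1 * (-1 * (f^\- w * V w) + f^\- w * U w) +
               (-1 * (f^\+ w * V w) + f^\+ w * U w)).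
  apply: eq_Rintegral => w _; have := posneg (f w).
  rewrite UV -/(f^\+ w) -/(f^\- w) => {1 2}<-; ring.
by rewrite !Rintegral_lincomb//; first lra; exact: integrable_lincomb.
Qed.

End Conditioning.

(** * Orthonormality and Fourier coefficients *)

Section Chaos.
Context (R : realType) d (Omega : measurableType d) (P : probability Omega R).
Context (Z : nat -> {RV P >-> R}) (Z_noise : normal_noise Z).
Implicit Types (sigma tau : {fset nat}) (T : set nat) (xi eta : cfun R Omega).

(** The real function underlying [Zprod], since conditional expectation is set up for real
    functions. *)
Definition Zreal sigma (w : Omega) : R := \prod_(i <- sigma) Z i w.

Lemma Z_gen_measurable T :
  \bigcup_(k in T) preimage_set_system setT (Z k) measurable
    `<=` d.-measurable.
Proof. by move=> _ [k _ [B mB <-]]; exact: measurable_funP. Qed.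

Lemma Zreal_adapted T sigma : (forall i, i \in sigma -> T i) ->
  adapted (sigma_gen Z T) (Zreal sigma).
Proof.
move=> sT; apply/adaptedP/measurable_prod => i /sT Ti.
by apply/adaptedP => A XA; apply: sub_gen_smallest; exists i.
Qed.

Lemma Zreal_measurable sigma : measurable_fun setT (Zreal sigma).
Proof. by apply: measurable_prod => i _; exact: measurable_funPT. Qed.

Lemma Zreal_fsetD1 n sigma w : n \in sigma ->
  Zreal sigma w = Z n w * Zreal (sigma `\ n)%fset w.
Proof. by move=> ns; rewrite /Zreal (big_fsetD1 n). Qed.

Lemma fset_ltnS n sigma : (forall i, i \in sigma -> (i < n.+1)%N) ->
  forall i, i \in (sigma `\ n)%fset -> (i < n)%N.
Proof.
move=> sn i; rewrite !inE => /andP[ni /sn]; rewrite ltnS leq_eqVlt.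
by rewrite (negbTE ni).
Qed.

(** Induction on a strict bound of [sigma]: the square of the product without [Z n] depends on the
    past of [n] only, so [Z n ^+ 2] may be replaced by 1. The nonnegative form of pulling out is
    used because square integrability of the products is only derived from this lemma. *)
Lemma Zreal_sq_integral sigma : (\int[P]_w (Zreal sigma w ^+ 2)%:E = 1)%E.
Proof.
have [n] : exists n, forall i, i \in sigma -> (i < n)%N.
  exists (\max_(i <- sigma) i).+1 => i si; rewrite ltnS.
  by rewrite (big_fsetD1 i)//= leq_maxl.
elim: n sigma => [|n IH] sigma sn.
  rewrite (_ : sigma = fset0); last first.
    by apply/fsetP => i; rewrite in_fset0; apply/negbTE/negP => /sn.
  under eq_integral do rewrite /Zreal big_seq_fset0 expr1n.
  by rewrite integral_cst// mul1e; exact: probability_setT.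
have [ns|ns] := boolP (n \in sigma); last first.
  apply: IH => i si; have := sn i si; rewrite ltnS leq_eqVlt => /predU1P[ie|//].
  by rewrite -ie si in ns.
have sn' := fset_ltnS _ _ sn.
have [_ _ [_ _ _ Z2]] := Z_noise n.
rewrite -(IH _ sn').
transitivity (\int[P]_w (Zreal (sigma `\ n)%fset w ^+ 2 * Z n w ^+ 2)%:E)%E.
  by apply: eq_integral => w _; rewrite (Zreal_fsetD1 _ _ _ ns) exprMn mulrC.
transitivity (\int[P]_w (Zreal (sigma `\ n)%fset w ^+ 2 * 1)%:E)%E; last first.
  by apply: eq_integral => w _; rewrite mulr1.
have := Zreal_adapted `I_n _ sn' => /adaptedP mZ.
apply: (ge0_pull_out _ _ _ _ _ (fun w => Zreal (sigma `\ n)%fset w ^+ 2)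
  (fun w => Z n w ^+ 2) (cst 1) (Z_gen_measurable `I_n)) => //.
- by apply/adaptedP; exact: measurable_funX.
- by move=> w; exact: sqr_ge0.
- by move=> w; exact: sqr_ge0.
- by apply: measurable_funX; exact: measurable_funPT.
- by move=> A GA; rewrite (Z2 A GA).
Qed.

Lemma Zreal_sq_integrable sigma :
  P.-integrable setT (fun w => (Zreal sigma w ^+ 2)%:E).
Proof.
apply/integrableP; split.
  by apply/measurable_EFinP/measurable_funX; exact: Zreal_measurable.
under eq_integral do rewrite gee0_abs ?lee_fin ?sqr_ge0//.
by rewrite Zreal_sq_integral ltry.
Qed.

Lemma Zreal_mul_integrable sigma tau :
  P.-integrable setT (fun w => (Zreal sigma w * Zreal tau w)%:E).
Proof.
apply: (integrable_dominated _ _ _ _ _ _ _ _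
  (integrable_lincomb _ _ _ _ 1 _ _ (Zreal_sq_integrable sigma)
    (Zreal_sq_integrable tau))).
  by apply: measurable_funM; exact: Zreal_measurable.
by move=> w; exact: mul_le_sqrD.
Qed.

(** [Z n] occurs exactly once in the product and all other factors belong to its past, so
    conditioning replaces it by 0. *)
Lemma Zreal_orthogonal1 n sigma tau :
  (forall i, i \in sigma -> (i < n.+1)%N) ->
  (forall i, i \in tau -> (i < n)%N) -> n \in sigma ->
  \int[P]_w (Zreal sigma w * Zreal tau w) = 0.
Proof.
move=> sn tn ns; have sn' := fset_ltnS _ _ sn.
have [_ Z1 _] := Z_noise n.
transitivity (\int[P]_w (Zreal (sigma `\ n)%fset w * Zreal tau w * Z n w)).
  by apply: eq_Rintegral => w _; rewrite (Zreal_fsetD1 _ _ _ ns); ring.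
have /adaptedP m1 := Zreal_adapted `I_n _ sn'.
have /adaptedP m2 := Zreal_adapted `I_n _ tn.
rewrite (pull_out _ _ _ _ _ _ _ (cst 0) (Z_gen_measurable `I_n) _ Z1).
- by under eq_Rintegral do rewrite mulr0; rewrite Rintegral_cst// mul0r.
- by apply/adaptedP; exact: measurable_funM.
- rewrite (_ : (fun w => _) = (fun w => (Zreal sigma w * Zreal tau w)%:E)).
    exact: Zreal_mul_integrable.
  apply/funext => w; congr EFin; rewrite (Zreal_fsetD1 _ _ _ ns); ring.
- rewrite (_ : (fun w => _) = (cst 0%E)); first exact: integrable0.
  by apply/funext => w /=; rewrite mulr0.
Qed.

(** Induction on a common strict bound. If the top index [n] lies in both sets, [Z n ^+ 2]
    conditions to 1 and [n] is removed from both; if it lies in one only, the integral is 0; if in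
    neither, the bound drops. *)
Lemma Zreal_orthonormal sigma tau :
  \int[P]_w (Zreal sigma w * Zreal tau w) = (sigma == tau)%:R.
Proof.
have [n] : exists n, forall i, i \in (sigma `|` tau)%fset -> (i < n)%N.
  exists (\max_(i <- (sigma `|` tau)%fset) i).+1 => i si; rewrite ltnS.
  by rewrite (big_fsetD1 i)//= leq_maxl.
elim: n sigma tau => [|n IH] sigma tau stn.
  have st0 (r : {fset nat}) : (r `<=` sigma `|` tau)%fset -> r = fset0.
    move=> rs; apply/fsetP => i; rewrite in_fset0; apply/negbTE/negP.
    by move=> /(fsubsetP rs)/stn.
  rewrite (st0 _ (fsubsetUl _ _)) (st0 _ (fsubsetUr _ _)) eqxx.
  rewrite -[LHS]/(fine _).
  under eq_integral do rewrite -expr2.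
  by rewrite Zreal_sq_integral.
have sn i : i \in sigma -> (i < n.+1)%N.
  by move=> si; apply: stn; rewrite inE si.
have tn i : i \in tau -> (i < n.+1)%N.
  by move=> si; apply: stn; rewrite inE si orbT.
have lt_n (r : {fset nat}) : (forall i, i \in r -> (i < n.+1)%N) ->
    n \notin r -> forall i, i \in r -> (i < n)%N.
  move=> rn nr i ri; have := rn i ri; rewrite ltnS leq_eqVlt => /predU1P[ie|//].
  by rewrite -ie ri in nr.
have [ns|ns] := boolP (n \in sigma); have [nt|nt] := boolP (n \in tau).
- have sn' := fset_ltnS _ _ sn; have tn' := fset_ltnS _ _ tn.
  have [_ _ Z2] := Z_noise n.
  have /adaptedP m1 := Zreal_adapted `I_n _ sn'.
  have /adaptedP m2 := Zreal_adapted `I_n _ tn'.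
  transitivity (\int[P]_w
      (Zreal (sigma `\ n)%fset w * Zreal (tau `\ n)%fset w * Z n w ^+ 2)).
    apply: eq_Rintegral => w _.
    by rewrite (Zreal_fsetD1 _ _ _ ns) (Zreal_fsetD1 _ _ _ nt); ring.
  rewrite (pull_out _ _ _ _ _ _ _ (cst 1) (Z_gen_measurable `I_n) _ Z2).
  + under eq_Rintegral do rewrite mulr1.
    rewrite IH; last by move=> i; rewrite inE => /orP[]; [exact: sn'|exact: tn'].
    congr (_%:R); congr nat_of_bool; apply/eqP/eqP => [st|->//].
    by rewrite -(fsetD1K ns) -(fsetD1K nt) st.
  + by apply/adaptedP; exact: measurable_funM.
  + rewrite (_ : (fun w => _) = (fun w => (Zreal sigma w * Zreal tau w)%:E)).
      exact: Zreal_mul_integrable.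
    apply/funext => w; congr EFin.
    by rewrite (Zreal_fsetD1 _ _ _ ns) (Zreal_fsetD1 _ _ _ nt); ring.
  + under [X in _ _ _ X]eq_fun do rewrite mulr1.
    exact: Zreal_mul_integrable.
- rewrite (Zreal_orthogonal1 n)//; last exact: lt_n.
  by case: eqP => // st; rewrite -st ns in nt.
- under eq_Rintegral do rewrite mulrC.
  rewrite (Zreal_orthogonal1 n)//; last exact: lt_n.
  by case: eqP => // st; rewrite st nt in ns.
- by apply: IH => i; rewrite inE => /orP[]; exact: lt_n.
Qed.

(** * The space [L2] and its inner product *)

Lemma L2_measurable xi : L2 Z xi ->
  measurable_fun setT (fun w => complex.Re (xi w)) /\
  measurable_fun setT (fun w => complex.Im (xi w)).
Proof.
by move=> [mr mi _]; split;
  [exact: (adapted_measurable _ _ _ _ _ (Z_gen_measurable setT) mr)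
  |exact: (adapted_measurable _ _ _ _ _ (Z_gen_measurable setT) mi)].
Qed.

Lemma L2_lincomb (a : R[i]) xi eta : L2 Z xi -> L2 Z eta ->
  L2 Z (a *: xi + eta).
Proof.
move=> xi2 eta2; have [xr xm] := L2_measurable _ xi2.
have [er em] := L2_measurable _ eta2.
case: xi2 eta2 => /adaptedP xr' /adaptedP xm' ix [/adaptedP er' /adaptedP em' ie].
have ReE w : complex.Re ((a *: xi + eta) w) =
    complex.Re a * complex.Re (xi w) - complex.Im a * complex.Im (xi w)
      + complex.Re (eta w).
  have -> : (a *: xi + eta) w = a * xi w + eta w by [].
  by case: (a) => a1 a2; case: (xi w) => x1 x2; case: (eta w).
have ImE w : complex.Im ((a *: xi + eta) w) =
    complex.Re a * complex.Im (xi w) + complex.Im a * complex.Re (xi w)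
      + complex.Im (eta w).
  have -> : (a *: xi + eta) w = a * xi w + eta w by [].
  by case: (a) => a1 a2; case: (xi w) => x1 x2; case: (eta w).
split.
- apply/adaptedP; rewrite [X in measurable_fun _ X](funext ReE).
  by apply: measurable_funD => //; apply: measurable_funB; exact: measurable_funM.
- apply/adaptedP; rewrite [X in measurable_fun _ X](funext ImE).
  by apply: measurable_funD => //; apply: measurable_funD; exact: measurable_funM.
- have i2 : P.-integrable setT (fun w => (2 * normc (eta w) ^+ 2)%:E).
    under eq_fun do rewrite EFinM; exact: integrableZl.
  apply: (integrable_dominated _ _ _ _ _ _ _ _
     (integrable_lincomb _ _ _ _ (2 * normc a ^+ 2) _ _ ix i2)) => [|w].
    rewrite [X in measurable_fun _ X](funext (fun w => normc_sq _ _)).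
    apply: measurable_funD; apply: measurable_funX.
      rewrite [X in measurable_fun _ X](funext ReE).
      by apply: measurable_funD => //; apply: measurable_funB; exact: measurable_funM.
    rewrite [X in measurable_fun _ X](funext ImE).
    by apply: measurable_funD => //; apply: measurable_funD; exact: measurable_funM.
  rewrite ger0_norm ?sqr_ge0// -mulrA -exprMn -normcM.
  exact: normc_sqD.
Qed.

Lemma L2_Zprod sigma : L2 Z (Zprod Z sigma).
Proof.
split.
- exact: (Zreal_adapted setT).
- by apply/adaptedP; exact: measurable_cst.
- rewrite (_ : (fun w => _) = (fun w => (Zreal sigma w ^+ 2)%:E)).
    exact: Zreal_sq_integrable.
  by apply/funext => w; congr EFin; rewrite normc_sq /= expr0n addr0.
Qed.

Lemma inner_integrable xi eta : L2 Z xi -> L2 Z eta ->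
  P.-integrable setT (fun w => (complex.Re ((xi w)^* * eta w))%:E) /\
  P.-integrable setT (fun w => (complex.Im ((xi w)^* * eta w))%:E).
Proof.
move=> xi2 eta2; have [xr xm] := L2_measurable _ xi2.
have [er em] := L2_measurable _ eta2.
have [_ _ ix] := xi2; have [_ _ ie] := eta2.
have := integrable_lincomb _ _ _ _ 1 _ _ ix ie => dom; split;
  apply: (integrable_dominated _ _ _ _ _ _ _ _ dom).
- rewrite (_ : (fun w => _) = (fun w => complex.Re (xi w) * complex.Re (eta w)
     + complex.Im (xi w) * complex.Im (eta w))).
    by apply: measurable_funD; exact: measurable_funM.
  apply/funext => w; case: (xi w) => a b; case: (eta w) => a' b' /=; ring.
- move=> w; apply: le_trans (mul_le_sqrD _ _ _).
  rewrite normrM !(ger0_norm (normc_ge0 _ _)) -(normc_conj _ (xi w)) -normcM.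
  exact: normr_Re_le.
- rewrite (_ : (fun w => _) = (fun w => complex.Re (xi w) * complex.Im (eta w)
     - complex.Im (xi w) * complex.Re (eta w))).
    by apply: measurable_funB; exact: measurable_funM.
  apply/funext => w; case: (xi w) => a b; case: (eta w) => a' b' /=; ring.
- move=> w; apply: le_trans (mul_le_sqrD _ _ _).
  rewrite normrM !(ger0_norm (normc_ge0 _ _)) -(normc_conj _ (xi w)) -normcM.
  exact: normr_Im_le.
Qed.

Lemma inner_linear (a : R[i]) xi eta zeta : L2 Z xi -> L2 Z eta -> L2 Z zeta ->
  inner P xi (a *: eta + zeta) = a * inner P xi eta + inner P xi zeta.
Proof.
move=> xi2 eta2 zeta2.
have [i1 i2] := inner_integrable _ _ xi2 eta2.
have [i3 i4] := inner_integrable _ _ xi2 zeta2.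
have E w : (xi w)^* * (a *: eta + zeta) w =
    a * ((xi w)^* * eta w) + (xi w)^* * zeta w.
  have -> : (a *: eta + zeta) w = a * eta w + zeta w by [].
  by rewrite mulrDr mulrCA.
(* Nested in the shape [k * X + Y], so that [Rintegral_lincomb] applies twice; likewise for the
   imaginary part. *)
have ReE w : complex.Re ((xi w)^* * (a *: eta + zeta) w) =
    complex.Re a * complex.Re ((xi w)^* * eta w) +
    (- complex.Im a * complex.Im ((xi w)^* * eta w) + complex.Re ((xi w)^* * zeta w)).
  rewrite E; case: (a) ((xi w)^* * eta w) ((xi w)^* * zeta w)
    => a1 a2 [x1 x2] [y1 y2] /=.
  by rewrite mulNr addrA.
have ImE w : complex.Im ((xi w)^* * (a *: eta + zeta) w) =
    complex.Re a * complex.Im ((xi w)^* * eta w) +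
    (complex.Im a * complex.Re ((xi w)^* * eta w) + complex.Im ((xi w)^* * zeta w)).
  rewrite E; case: (a) ((xi w)^* * eta w) ((xi w)^* * zeta w)
    => a1 a2 [x1 x2] [y1 y2] /=.
  by rewrite addrA.
have int_Re : \int[P]_w complex.Re ((xi w)^* * (a *: eta + zeta) w) =
    complex.Re a * \int[P]_w complex.Re ((xi w)^* * eta w) +
    (- complex.Im a * \int[P]_w complex.Im ((xi w)^* * eta w)
     + \int[P]_w complex.Re ((xi w)^* * zeta w)).
  rewrite -!Rintegral_lincomb//; last exact: integrable_lincomb.
  by apply: eq_Rintegral => w _.
have int_Im : \int[P]_w complex.Im ((xi w)^* * (a *: eta + zeta) w) =
    complex.Re a * \int[P]_w complex.Im ((xi w)^* * eta w) +
    (complex.Im a * \int[P]_w complex.Re ((xi w)^* * eta w)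
     + \int[P]_w complex.Im ((xi w)^* * zeta w)).
  rewrite -!Rintegral_lincomb//; last exact: integrable_lincomb.
  by apply: eq_Rintegral => w _.
rewrite /inner int_Re int_Im; case: (a) => a1 a2; apply/eqP.
by rewrite eq_complex /=; apply/andP; split; apply/eqP; ring.
Qed.

Lemma inner_Zprod sigma tau :
  inner P (Zprod Z sigma) (Zprod Z tau) = (sigma == tau)%:R.
Proof.
have E w : (Zprod Z sigma w)^* * Zprod Z tau w = (Zreal sigma w * Zreal tau w)%:C.
  rewrite rmorphM; congr (_ * _); apply/eqP.
  by rewrite eq_complex /= oppr0 !eqxx.
rewrite /inner (_ : \int[P]_w _ = (sigma == tau)%:R); last first.
  by rewrite -Zreal_orthonormal; apply: eq_Rintegral => w _; rewrite E.
rewrite (_ : \int[P]_w _ = 0); last first.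
  rewrite -[RHS](mul0r (fine (P setT))) -(Rintegral_cst _ measurableT).
  by apply: eq_Rintegral => w _; rewrite E.
by case: (sigma == tau).
Qed.

(** * Fourier coefficients and the weighted spaces [Sp_space] *)

Notation coef sigma xi := (inner P (Zprod Z sigma) xi).
Notation weight p sigma := (lambda R sigma `^ (2 * p)).

Local Arguments normc : simpl never.

Lemma weight_gt0 (p : R) sigma : 0 < weight p sigma.
Proof. by rewrite powR_gt0// prodr_gt0. Qed.

Lemma coef_linear sigma (a : R[i]) xi eta : L2 Z xi -> L2 Z eta ->
  coef sigma (a *: xi + eta) = a * coef sigma xi + coef sigma eta.
Proof. by move=> *; apply: inner_linear => //; exact: L2_Zprod. Qed.

Lemma L2_subr xi eta : L2 Z xi -> L2 Z eta -> L2 Z (xi - eta).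
Proof. by move=> x2 e2; rewrite -scaleN1r addrC; exact: L2_lincomb. Qed.

Lemma coef_subr sigma xi eta : L2 Z xi -> L2 Z eta ->
  coef sigma (xi - eta) = coef sigma xi - coef sigma eta.
Proof.
by move=> x2 e2; rewrite -scaleN1r addrC coef_linear// mulN1r addrC.
Qed.

Lemma L2_0 : L2 Z 0.
Proof.
rewrite -(subrr (Zprod Z fset0)).
by have := L2_subr _ _ (L2_Zprod fset0) (L2_Zprod fset0).
Qed.

Lemma coef0 sigma : coef sigma 0 = 0.
Proof.
rewrite -(subrr (coef sigma (Zprod Z fset0))) -coef_subr ?subrr//;
  exact: L2_Zprod.
Qed.

Lemma sqnorm_term_ge0 (p : R) xi sigma :
  0 <= weight p sigma * normc (coef sigma xi) ^+ 2.
Proof. by rewrite mulr_ge0 ?sqr_ge0// ltW// weight_gt0. Qed.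

Lemma sqnorm_ge0 (p : R) xi : (0 <= sqnorm Z p xi)%E.
Proof. by apply: esum_ge0 => s _; rewrite lee_fin; exact: sqnorm_term_ge0. Qed.

Lemma sqr_normp (p : R) xi : (sqnorm Z p xi < +oo)%E ->
  ((normp Z p xi ^+ 2)%:E = sqnorm Z p xi)%E.
Proof.
move=> xfin; rewrite sqr_sqrtr ?fine_ge0 ?sqnorm_ge0// fineK//.
by rewrite ge0_fin_numE// sqnorm_ge0.
Qed.

Lemma normp_le (p : R) xi (c : R) : 0 <= c ->
  (sqnorm Z p xi <= (c ^+ 2)%:E)%E -> normp Z p xi <= c.
Proof.
move=> c0 xc; have xfin := le_lt_trans xc (ltry _).
by move: xc; rewrite -sqr_normp// lee_fin ler_sqr ?nnegrE// sqrtr_ge0.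
Qed.

Lemma sum_le_sqr_normp (p : R) xi (F : {fset {fset nat}}) :
  (sqnorm Z p xi < +oo)%E ->
  \sum_(s <- F) weight p s * normc (coef s xi) ^+ 2 <= normp Z p xi ^+ 2.
Proof.
move=> xfin; move: F; apply/esum_leP; first exact: sqnorm_term_ge0.
by rewrite sqr_normp.
Qed.

Lemma Sp_lincomb (p : R) (a : R[i]) xi eta :
  Sp_space Z p xi -> Sp_space Z p eta -> Sp_space Z p (a *: xi + eta).
Proof.
move=> [x2 xfin] [e2 efin]; split; first exact: L2_lincomb.
apply/esum_ltyP; first exact: sqnorm_term_ge0.
(* This bound is [normc_sqD] summed over the coefficients. *)
exists (2 * normc a ^+ 2 * normp Z p xi ^+ 2 + 2 * normp Z p eta ^+ 2) => F.
have a2 : 0 <= 2 * normc a ^+ 2 by rewrite mulr_ge0// sqr_ge0.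
apply: le_trans (lerD (ler_wpM2l a2 (sum_le_sqr_normp _ _ F xfin))
  (ler_wpM2l (ler0n _ 2) (sum_le_sqr_normp _ _ F efin))).
rewrite !mulr_sumr -big_split/=; apply: ler_sum => s _.
rewrite coef_linear//.
apply: le_trans (ler_wpM2l (ltW (weight_gt0 p s)) (normc_sqD _ _ _)) _.
by rewrite normcM exprMn le_eqVlt; apply/orP; left; apply/eqP; ring.
Qed.

Lemma Sp_subr (p : R) xi eta :
  Sp_space Z p xi -> Sp_space Z p eta -> Sp_space Z p (xi - eta).
Proof. by move=> xp ep; rewrite -scaleN1r addrC; exact: Sp_lincomb. Qed.

Lemma normp_triangle (p : R) xi eta zeta :
  Sp_space Z p xi -> Sp_space Z p eta -> Sp_space Z p zeta ->
  normp Z p (xi - zeta) <= normp Z p (xi - eta) + normp Z p (eta - zeta).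
Proof.
move=> xp ep zp; have [x2 _] := xp; have [e2 _] := ep; have [z2 _] := zp.
have [_ d1] := Sp_subr _ _ _ xp ep; have [_ d2] := Sp_subr _ _ _ ep zp.
apply: normp_le; first by rewrite addr_ge0// sqrtr_ge0.
apply: le_trans (minkowski _ _ _ _ _ (fun s => ltW (weight_gt0 p s)) d1 d2).
by apply: le_esum => s _; rewrite !coef_subr// subrKA.
Qed.

Lemma normpZ_le (p : R) (a : R[i]) xi : Sp_space Z p xi ->
  normp Z p (a *: xi) <= normc a * normp Z p xi.
Proof.
move=> [x2 xfin].
apply: normp_le; first by rewrite mulr_ge0 ?normc_ge0 ?sqrtr_ge0.
apply/esum_leP => [s|F]; first exact: sqnorm_term_ge0.
rewrite exprMn.
apply: le_trans (ler_wpM2l (sqr_ge0 (normc a)) (sum_le_sqr_normp _ _ F xfin)).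
rewrite mulr_sumr; apply: ler_sum => s _; 
rewrite -[a *: xi]addr0 coef_linear//; last exact: L2_0.
by rewrite coef0 addr0 normcM exprMn mulrCA.
Qed.

(** * Finite Fourier sums and the expansion of functionals *)

Definition combination (r : seq {fset nat}) (g : {fset nat} -> R[i]) :
    cfun R Omega :=
  \sum_(sigma <- r) g sigma *: Zprod Z sigma.

Lemma L2_combination r g : L2 Z (combination r g).
Proof.
rewrite /combination; elim: r => [|s r IH]; first by rewrite big_nil; exact: L2_0.
by rewrite big_cons; apply: L2_lincomb => //; exact: L2_Zprod.
Qed.

Lemma coef_combination r g tau : uniq r ->
  coef tau (combination r g) = if tau \in r then g tau else 0.
Proof.
elim: r => [|s r IH]; first by rewrite /combination big_nil coef0.
rewrite cons_uniq => /andP[sr /IH coefr]; rewrite /combination big_cons.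
rewrite coef_linear; [|exact: L2_Zprod|exact: L2_combination].
rewrite [X in _ + X]coefr inner_Zprod inE; have [->|ts] := eqVneq tau s.
  by rewrite (negbTE sr) mulr1 addr0.
by rewrite mulr0 add0r.
Qed.

Lemma sqnorm_combination (p : R) (F : {fset {fset nat}}) g :
  sqnorm Z p (combination F g) =
  (\sum_(s <- F) weight p s * normc (g s) ^+ 2)%:E.
Proof.
rewrite /sqnorm (eq_esum (b := fun s => if s \in [set` F] then
    (weight p s * normc (g s) ^+ 2)%:E else 0%E)); last first.
  move=> s _; rewrite coef_combination ?fset_uniq// mem_setE; case: ifP => // _.
  by rewrite normc0 expr0n mulr0.
rewrite -esum_mkcond esum_fset//; last first.
  by move=> s _; rewrite lee_fin mulr_ge0 ?sqr_ge0// ltW// weight_gt0.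
by rewrite -fsbig_seq// sumEFin.
Qed.

Lemma Sp_combination (p : R) (F : {fset {fset nat}}) g :
  Sp_space Z p (combination F g).
Proof. by split; [exact: L2_combination|rewrite sqnorm_combination ltry]. Qed.

Lemma Sp_Zprod (p : R) sigma : Sp_space Z p (Zprod Z sigma).
Proof.
have := Sp_combination p [fset sigma]%fset (cst 1).
by rewrite /combination big_seq_fset1 scale1r.
Qed.

Lemma Sp_0 (p : R) : Sp_space Z p 0.
Proof. by have := Sp_combination p fset0 (cst 0); rewrite /combination big_nil. Qed.

Lemma Sp_scale (p : R) (a : R[i]) xi : Sp_space Z p xi -> Sp_space Z p (a *: xi).
Proof.
by move=> xp; rewrite -[a *: xi]addr0; exact: Sp_lincomb _ _ _ _ xp (Sp_0 p).
Qed.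

(** By orthonormality the coefficients of the difference vanish on [F] and are those of [- xi]
    elsewhere, so its squared norm is a tail of the series [sqnorm Z p xi]. *)
Lemma truncation_cvg (p : R) xi : Sp_space Z p xi -> forall e : R, 0 < e ->
  exists F0 : {fset {fset nat}}, forall F, (F0 `<=` F)%fset ->
    normp Z p (combination F (fun s => coef s xi) - xi) < e.
Proof.
move=> [x2 xfin] e e0.
have e2 : 0 < (e / 2) ^+ 2 by rewrite exprn_gt0// divr_gt0.
have [F0 F0P] := esum_tail _ _ _ (sqnorm_term_ge0 p xi) xfin _ e2.
exists F0 => F /F0P tail_le.
suff : normp Z p (combination F (fun s => coef s xi) - xi) <= e / 2.
  by move=> /le_lt_trans; apply; lra.
apply: normp_le; first by rewrite divr_ge0// ltW.
apply: le_trans tail_le; apply: le_esum => s _.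
rewrite coef_subr//; last exact: L2_combination.
rewrite coef_combination ?fset_uniq//; case: ifP => _.
  by rewrite subrr normc0 expr0n mulr0.
by rewrite sub0r normcN.
Qed.

(** [D] stays abstract to cover both [Sp_space] and intersections of such spaces. Membership in [D]
    is carried through the induction, as [Phi] is linear on [D] only. *)
Lemma linear_combination (D : set (cfun R Omega)) (Phi : cfun R Omega -> R[i])
    r g :
  (forall (a : R[i]) xi eta, D xi -> D eta -> D (a *: xi + eta)) ->
  (forall s, D (Zprod Z s)) -> linear_on D Phi ->
  Phi (combination r g) = \sum_(s <- r) g s * Phi (Zprod Z s).
Proof.
move=> Dlin DZ Phil.
have D0 : D 0.
  have := Dlin (-1) _ _ (DZ fset0) (DZ fset0).
  by rewrite scaleN1r addNr.
have Phi0 := linear_on0 _ _ _ _ Phil D0.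
suff [] : D (combination r g) /\
  Phi (combination r g) = \sum_(s <- r) g s * Phi (Zprod Z s) by [].
rewrite /combination; elim: r => [|s r [Dr IH]]; first by rewrite !big_nil.
by rewrite !big_cons Phil// IH; split => //; exact: Dlin.
Qed.

(* The case of a singleton [K] is the expansion of a functional on [Sp_space],
   that of all [q >= 0] the expansion of a functional on [S_space]. *)
Lemma dual_expansion (K : set R) (Phi : cfun R Omega -> R[i]) xi :
  dual K (normp Z) (\bigcap_(q in K) Sp_space Z q) Phi ->
  (forall q, K q -> Sp_space Z q xi) ->
  has_sum _ _ (fun s => coef s xi * Phi (Zprod Z s)) (Phi xi).
Proof.
move=> Phid xK e e0; set D := \bigcap_(q in K) _ in Phid.
have tri k x y z : K k -> D x -> D y -> D z ->
    normp Z k (x - z) <= normp Z k (x - y) + normp Z k (y - z).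
  by move=> Kk Dx Dy Dz; apply: normp_triangle; [exact: Dx|exact: Dy|exact: Dz].
have [s [t [sK t0 st]]] := dual_continuous_at _ _ _ _ _ _ _ tri Phid xi e xK e0.
(* Continuity at [xi] involves only the finitely many norms listed in [s], so one finite set makes
   the truncations close in all of them. *)
have [|F0 F0P] := eventually_all _ s _
    (fun k F => normp Z k (combination F (fun s => coef s xi) - xi) < t).
  by move=> k /sK Kk; apply: truncation_cvg => //; exact: xK.
exists F0 => F /F0P near.
have <- : Phi (combination F (fun s => coef s xi)) =
    \sum_(x <- F) coef x xi * Phi (Zprod Z x).
  apply: (linear_combination D); last by case: Phid.
  - by move=> a x y Dx Dy q Kq; apply: Sp_lincomb; [exact: Dx|exact: Dy].
  - by move=> q k _; exact: Sp_Zprod.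
rewrite -normcN opprB; apply: st near => q _; exact: Sp_combination.
Qed.

(** Weighted Cauchy-Schwarz, with the weight on the coefficients of [xi] and its inverse on
    [phi]. *)
Lemma pairing_bound (p : R) (phi : {fset nat} -> R[i]) xi (F : {fset {fset nat}}) :
  (sqnorm Z p xi < +oo)%E ->
  (\esum_(s in [set: {fset nat}])
    ((weight p s)^-1 * normc (phi s) ^+ 2)%:E < +oo)%E ->
  \sum_(s <- F) normc (coef s xi * phi s) <= Num.sqrt (fine
    (\esum_(s in [set: {fset nat}]) ((weight p s)^-1 * normc (phi s) ^+ 2)%:E))
    * normp Z p xi.
Proof.
move=> xfin phifin; have w0 := weight_gt0 p.
have phi0 s : 0 <= (weight p s)^-1 * normc (phi s) ^+ 2.
  by rewrite mulr_ge0 ?sqr_ge0// invr_ge0 ltW.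
have A := sum_le_sqr_normp _ _ F xfin.
have B := sum_le_fine_esum _ _ _ F phi0 phifin.
rewrite -[leLHS]ger0_norm; last by apply: sumr_ge0 => s _; exact: normc_ge0.
rewrite -[normp _ _ _]ger0_norm ?sqrtr_ge0// -!sqrtr_sqr -sqrtrM; last first.
  by apply: le_trans B; apply: sumr_ge0 => s _; exact: phi0.
rewrite ler_wsqrtr// mulrC.
under eq_bigr do rewrite normcM.
apply: le_trans (weighted_cauchy_schwarz _ _ F _ _ _ w0) _.
by apply: ler_pM A B; apply: sumr_ge0 => s _ //; exact: sqnorm_term_ge0.
Qed.

(** * The Fock series and the dual norm *)

Section Fock.
Context (p : R) (phi : {fset nat} -> R[i]).

(** The inverse weight is the form in which weighted Cauchy-Schwarz produces the series; [powRN]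
    later matches it with the exponent -2p. *)
Definition fock_series : \bar R :=
  \esum_(s in [set: {fset nat}]) ((weight p s)^-1 * normc (phi s) ^+ 2)%:E.

Lemma fock_term_ge0 s : 0 <= (weight p s)^-1 * normc (phi s) ^+ 2.
Proof. by rewrite mulr_ge0 ?sqr_ge0// invr_ge0 ltW// weight_gt0. Qed.

(** Only the expansion of [Psi] enters, so the bound is available for proving that the extension is
    continuous. *)
Lemma functional_bound (Psi : cfun R Omega -> R[i]) : (fock_series < +oo)%E ->
  (forall xi, Sp_space Z p xi ->
    has_sum _ _ (fun s => coef s xi * phi s) (Psi xi)) ->
  forall xi, Sp_space Z p xi ->
    normc (Psi xi) <= Num.sqrt (fine fock_series) * normp Z p xi.
Proof.
move=> phifin Psisum xi xp; apply: (has_sum_le _ _ _ _ _ (Psisum _ xp)) => F.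
apply: le_trans (normc_sum _ _ _ _) _.
have [_ xfin] := xp.
exact: (pairing_bound p phi xi F xfin phifin).
Qed.

(** The expansion itself defines the extension: it converges absolutely by [pairing_bound], is
    linear by uniqueness of sums, and is Lipschitz by [functional_bound]. *)
Lemma extension_exists : (fock_series < +oo)%E ->
  exists2 Psi, Sp_dual Z p Psi & forall xi, Sp_space Z p xi ->
    has_sum _ _ (fun s => coef s xi * phi s) (Psi xi).
Proof.
move=> phifin.
(* The default 0 is the value where the series has no sum, which cannot happen on [Sp_space]. *)
pose Psi xi := xget 0 [set z | has_sum _ _ (fun s => coef s xi * phi s) z].
have Psisum xi : Sp_space Z p xi ->
    has_sum _ _ (fun s => coef s xi * phi s) (Psi xi).
  move=> [_ xfin]; rewrite /Psi; case: xgetP => // Psi0.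
  have [z zsum] : exists z, has_sum _ _ (fun s => coef s xi * phi s) z.
    apply: has_sum_exists; apply/esum_ltyP => [s|]; first exact: normc_ge0.
    exists (Num.sqrt (fine fock_series) * normp Z p xi) => F.
    exact: (pairing_bound p phi xi F xfin phifin).
  by have := Psi0 z.
have Psilin : linear_on (Sp_space Z p) Psi.
  move=> a x y xp yp; have [x2 _] := xp; have [y2 _] := yp.
  apply: has_sum_unique (Psisum _ (Sp_lincomb _ a _ _ xp yp)) _.
  have -> : (fun s => coef s (a *: x + y) * phi s) =
      (fun s => a * (coef s x * phi s) + coef s y * phi s).
    by apply/funext => s; rewrite coef_linear// mulrDl mulrA.
  by apply: has_sum_linear; exact: Psisum.
have norm0 : normp Z p 0 = 0.
  apply/le_anti; rewrite sqrtr_ge0 andbT.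
  have := normpZ_le p 0 _ (Sp_Zprod p fset0).
  by rewrite scale0r normc0 mul0r.
(* Adding 1 keeps the Lipschitz constant positive when the series is 0. *)
have C0 : 0 < Num.sqrt (fine fock_series) + 1 by rewrite ltr_wpDl// sqrtr_ge0.
have lip x y : Sp_space Z p x -> Sp_space Z p y ->
    normc (Psi x - Psi y) <= (Num.sqrt (fine fock_series) + 1) * normp Z p (y - x).
  move=> xp yp; rewrite -normcN opprB.
  have -> : Psi y - Psi x = Psi (y - x).
    have -> : y - x = -1 *: x + y by rewrite scaleN1r addrC.
    by rewrite (Psilin _ _ _ xp yp) mulN1r addrC.
  apply: le_trans (functional_bound _ phifin Psisum _ (Sp_subr _ _ _ yp xp)) _.
  by rewrite ler_wpM2r ?sqrtr_ge0// lerDl.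
exists Psi => //; split => //.
exact: (lipschitz_continuous _ _ _ p (normp Z) (Sp_space Z p) Psi _ C0 norm0 lip).
Qed.

(** Continuity at 0 gives [t] such that [Psi] is below 1 in modulus on the ball of radius [t];
    scaling the unit ball by [t / 2] lands there. This makes the [sup] in [dual_norm] a genuine
    supremum. *)
Lemma dual_unit_ball_bounded (Psi : cfun R Omega -> R[i]) : Sp_dual Z p Psi ->
  has_ubound [set normc (Psi xi) | xi in
    [set xi | Sp_space Z p xi /\ normp Z p xi <= 1]].
Proof.
move=> Psid; have [Psilin _] := Psid.
have Sp0 := Sp_0 p.
have PsiZ a x := linear_onZ _ _ _ _ a x Psilin Sp0.
have tri k x y z : [set p] k -> Sp_space Z p x -> Sp_space Z p y ->
    Sp_space Z p z ->
    normp Z k (x - z) <= normp Z k (x - y) + normp Z k (y - z).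
  by move=> -> *; exact: normp_triangle.
have [s [t [sp t0 st]]] :=
  dual_continuous_at _ _ _ _ _ _ _ tri Psid 0 1 Sp0 ltr01.
exists (2 / t) => _ [xi [xp xi1] <-].
have t2 : 0 < t / 2 by rewrite divr_gt0.
have txp := Sp_scale _ (t / 2)%:C _ xp.
have : normc (Psi 0 - Psi ((t / 2)%:C *: xi)) < 1.
  apply: st => // k /sp ->; rewrite subr0.
  apply: le_lt_trans (normpZ_le _ _ _ xp) _.
  rewrite normc_real gtr0_norm//.
  by apply: le_lt_trans (ler_wpM2l (ltW t2) xi1) _; rewrite mulr1; lra.
rewrite (linear_on0 _ _ _ _ Psilin Sp0) sub0r normcN (PsiZ _ _ xp) normcM.
rewrite normc_real gtr0_norm// => h; rewrite ler_pdivlMr//; lra.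
Qed.

(** For a finite part S of the series, the test vector [xi] has norm the root of S and value S, so
    its normalization attains the root of S in the unit ball. *)
Lemma fock_series_le (Psi : cfun R Omega -> R[i]) : Sp_dual Z p Psi ->
  (forall s, Psi (Zprod Z s) = phi s) ->
  (fock_series <= (dual_norm Z p Psi ^+ 2)%:E)%E.
Proof.
move=> Psid Psiphi; have ub := dual_unit_ball_bounded _ Psid.
have [Psilin _] := Psid.
apply/esum_leP => [s|F]; first exact: fock_term_ge0.
set S := \sum_(s <- F) _; have S0 : 0 <= S.
  by apply: sumr_ge0 => s _; exact: fock_term_ge0.
(* The case S = 0 is separate because normalizing divides by the root of S. *)
have [->|Sneq0] := eqVneq S 0; first exact: sqr_ge0.
have Sgt0 : 0 < S by rewrite lt0r Sneq0.
(* Riesz representative of the truncation of [Psi] to [F]. *)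
pose xi := combination F (fun s => ((weight p s)^-1)%:C * (phi s)^*).
have xp : Sp_space Z p xi by exact: Sp_combination.
have normE : normp Z p xi = Num.sqrt S.
  rewrite /normp sqnorm_combination /=; congr Num.sqrt.
  apply: eq_bigr => s _; have w0 := weight_gt0 p s.
  rewrite normcM normc_real normc_conj gtr0_norm ?invr_gt0// exprMn mulrA.
  by congr (_ * _); rewrite expr2 mulrA mulfV ?mul1r// gt_eqF.
have PsiE : Psi xi = S%:C.
  rewrite (linear_combination _ _ F _ (Sp_lincomb p) (Sp_Zprod p) Psilin).
  rewrite /S rmorph_sum; apply: eq_bigr => s _; rewrite Psiphi -mulrA rmorphM.
  congr (_ * _); rewrite normc_sq; case: (phi s) => x y; apply/eqP.
  rewrite eq_complex /=.
  by apply/andP; split; apply/eqP; ring.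
have sS : 0 < Num.sqrt S by rewrite sqrtr_gt0.
have Sp0 := Sp_0 p.
have PsiZ a x := linear_onZ _ _ _ _ a x Psilin Sp0.
have : Num.sqrt S <= dual_norm Z p Psi.
  apply: ub_le_sup => //; exists ((Num.sqrt S)^-1%:C *: xi).
    split; first exact: Sp_scale.
    apply: le_trans (normpZ_le _ _ _ xp) _.
    by rewrite normc_real gtr0_norm ?invr_gt0// normE mulVf// gt_eqF.
  rewrite (PsiZ _ _ xp) PsiE normcM !normc_real.
  rewrite !gtr0_norm ?invr_gt0// -[X in _ * X](sqr_sqrtr S0) expr2 mulrA.
  by rewrite mulVf ?mul1r// gt_eqF.
move=> le_sS; rewrite -[leLHS](sqr_sqrtr S0) ler_sqr// ?nnegrE ?(ltW sS)//.
exact: le_trans (ltW sS) le_sS.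
Qed.

(** [functional_bound] on the unit ball bounds the supremum. Nonnegativity, needed to square this
    bound, comes from the vector 0, which also shows that the set of values is nonempty. *)
Lemma dual_norm_le (Psi : cfun R Omega -> R[i]) : (fock_series < +oo)%E ->
  (forall xi, Sp_space Z p xi ->
    has_sum _ _ (fun s => coef s xi * phi s) (Psi xi)) ->
  0 <= dual_norm Z p Psi /\ ((dual_norm Z p Psi ^+ 2)%:E <= fock_series)%E.
Proof.
move=> phifin Psisum.
have Sp0 := Sp_0 p.
have norm0 : normp Z p 0 <= 1.
  have := normpZ_le p 0 _ (Sp_Zprod p fset0).
  by rewrite scale0r normc0 mul0r => /le_trans; apply.
have ub : ubound [set normc (Psi xi) | xi in
    [set xi | Sp_space Z p xi /\ normp Z p xi <= 1]]
    (Num.sqrt (fine fock_series)).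
  move=> _ [xi [xp xi1] <-].
  apply: le_trans (functional_bound _ phifin Psisum _ xp) _.
  by rewrite -[leRHS]mulr1 ler_wpM2l// sqrtr_ge0.
have ge0 : 0 <= dual_norm Z p Psi.
  apply: le_trans (normc_ge0 _ (Psi 0)) _.
  by apply: ub_le_sup; [eexists; exact: ub|exists 0].
split => //.
have fock0 : (0 <= fock_series)%E.
  by apply: esum_ge0 => s _; rewrite lee_fin; exact: fock_term_ge0.
rewrite -[leRHS]fineK ?ge0_fin_numE// lee_fin.
rewrite -[leRHS](sqr_sqrtr (fine_ge0 fock0)) ler_sqr ?nnegrE ?sqrtr_ge0//.
by apply: ge_sup => //; exists (normc (Psi 0)); exists 0.
Qed.

End Fock.

End Chaos.

(** * Characterization of [Sp_dual] and of its norm by the Fock series *)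

Theorem theorem2p8 (R : realType) (d : measure_display)
    (Omega : measurableType d) (P : probability Omega R)
    (Z : nat -> {RV P >-> R})
    (Z_noise : normal_noise Z) (Z_chaotic : chaotic_representation Z)
    (Phi : cfun R Omega -> R[i]) (Phi_dual : S_dual Z Phi)
    (p : R) (p_ge0 : 0 <= p) :
  let fock_sum : \bar R :=
    \esum_(sigma in [set: {fset nat}])
      (lambda R sigma `^ (- (2 * p))
        * normc (fock_transform Z Phi sigma) ^+ 2)%:E in
  ((exists2 Psi, Sp_dual Z p Psi & restricts_to Z Psi Phi)
     <-> (fock_sum < +oo)%E)
  /\ (forall Psi, Sp_dual Z p Psi -> restricts_to Z Psi Phi ->
        ((dual_norm Z p Psi ^+ 2)%:E = fock_sum)%E).
Proof.
move=> T.
have TE : T = fock_series R p (fock_transform Z Phi).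
  by apply: eq_esum => s _; rewrite powRN.
have S_Z s : S_space Z (Zprod Z s).
  by move=> q _; exact: (Sp_Zprod _ _ _ _ _ Z_noise).
have S_Sp xi : S_space Z xi -> Sp_space Z p xi by move=> /(_ p p_ge0).
have PsiZ Psi : restricts_to Z Psi Phi ->
    forall s, Psi (Zprod Z s) = fock_transform Z Phi s.
  by move=> PsiPhi s; exact: PsiPhi.
split; first split.
- move=> [Psi Psid /PsiZ PsiPhi]; rewrite TE.
  apply: le_lt_trans (ltry (dual_norm Z p Psi ^+ 2)).
  exact: (fock_series_le _ _ _ _ _ Z_noise p _ Psi Psid PsiPhi).
- rewrite TE => Tfin.
  have [Psi Psid Psisum] := extension_exists _ _ _ _ _ Z_noise p _ Tfin.
  exists Psi => // xi Sxi.
  (* On [S_space], the extension and [Phi] are both sums of the same series. *)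
  apply: (has_sum_unique _ _ _ _ _ (Psisum _ (S_Sp _ Sxi))).
  exact: (dual_expansion _ _ _ _ _ Z_noise [set q : R | 0 <= q] Phi xi Phi_dual Sxi).
move=> Psi Psid /PsiZ PsiPhi; rewrite TE.
have le_T := fock_series_le _ _ _ _ _ Z_noise p _ Psi Psid PsiPhi.
have Tfin := le_lt_trans le_T (ltry _).
apply/le_anti; rewrite le_T andbT.
(* [Psi] is an arbitrary continuous extension here, so its expansion comes from its own continuity
   in the single norm [p]. *)
have Psisum xi : Sp_space Z p xi -> has_sum R _
    (fun s => inner P (Zprod Z s) xi * fock_transform Z Phi s) (Psi xi).
  move=> xp; rewrite (_ : (fun s => _) =
      (fun s => inner P (Zprod Z s) xi * Psi (Zprod Z s))); last first.
    by apply/funext => s; rewrite PsiPhi.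
  apply: (dual_expansion _ _ _ _ _ Z_noise [set p] Psi xi).
    by rewrite bigcap_set1.
  by move=> q ->.
by have [] := dual_norm_le _ _ _ _ _ Z_noise p _ Psi Tfin Psisum.
Qed.
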